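(* Every flotilla $H$ satisfies the Erdős–Hajnal Conjecture: there exists $\epsilon(H)>0$ such that every $H$-free tournament $T$ with $n$ vertices contains a transitive subtournament with at least $n^{\epsilon(H)}$ vertices.
   Context: A tournament is a digraph in which for every pair of distinct vertices $u,v$ exactly one of the arcs $(u,v),(v,u)$ is present; it is transitive if it has no directed cycle. $T$ contains $H$ if $H$ is isomorphic to an induced subtournament of $T$; otherwise $T$ is $H$-free. For an ordering $\theta=(v_1,\dots,v_n)$ of $V(T)$, an arc $(v_i,v_j)$ is backward if $i>j$, and $B(T,\theta)$ is the undirected graph on $V(T)$ whose edges are the pairs joined by a backward arc. A left boat in $B(T,\theta)$ is a set $\{v_{i_1},v_{i_2},v_{i_3},v_{i_4}\}$ with $i_1<i_2<i_3<i_4$ and $i_3=i_2+1=i_1+2$ such that the subgraph of $B(T,\theta)$ induced on it has exactly the edges $v_{i_1}v_{i_3}$, $v_{i_1}v_{i_4}$, $v_{i_2}v_{i_4}$. A right boat is defined identically except that $i_4=i_3+1=i_2+2$ instead. A tournament $H$ is a flotilla if there exists an ordering $\theta$ of $V(H)$ such that every connected component of $B(H,\theta)$ is a left boat or a right boat. *)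

(* Defs.v *)
From HB Require Import structures.
From mathcomp Require Import all_boot all_order all_algebra.
From mathcomp Require Import reals exp.

Set Implicit Arguments.
Unset Strict Implicit.
Unset Printing Implicit Defensive.

Import Order.TTheory GRing.Theory Num.Theory.

Record tournament := Tournament {
  vertex :> finType;
  darc : rel vertex;
  darc_irr : irreflexive darc;
  darc_xor : forall u v : vertex, u != v -> darc u v (+) darc v u
}.

Section Subtournament.
Variables (T : tournament) (S : {set T}).

Let sub_darc : rel {x : T | x \in S} := fun u v => darc (val u) (val v).

Fact sub_darc_irr : irreflexive sub_darc.
Proof. by move=> u; apply: darc_irr. Qed.

Fact sub_darc_xor (u v : {x : T | x \in S}) :
  u != v -> sub_darc u v (+) sub_darc v u.
Proof. by move=> neq_uv; apply: darc_xor; rewrite val_eqE. Qed.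

Definition subtournament : tournament :=
  @Tournament {x : T | x \in S} sub_darc sub_darc_irr sub_darc_xor.

End Subtournament.

Definition isomorphic (H K : tournament) : Prop :=
  exists2 f : H -> K, bijective f & forall u v, darc (f u) (f v) = darc u v.

Definition contains (T H : tournament) : Prop :=
  exists S : {set T}, isomorphic H (subtournament S).

Definition free (H T : tournament) : Prop := ~ contains T H.

(* [ucycle] accepts the empty sequence, which is not a directed cycle; a
   one-vertex cycle would be a loop, and a two-vertex cycle a pair of opposite
   arcs, so every nonempty [c] here has at least three vertices. *)
Definition transitive_tournament (T : tournament) : Prop :=
  forall c : seq T, c != [::] -> ~ ucycle (@darc T) c.

Section Flotilla.
Variable H : tournament.

Definition ordering (theta : seq H) : Prop := perm_eq theta (enum H).

(* Positions are counted from 0 by [index]; only their order and differences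
   matter below. *)
Definition backward (theta : seq H) : rel H :=
  fun u v => darc u v && (index v theta < index u theta).

Definition backedge_graph (theta : seq H) : rel H :=
  fun u v => backward theta u v || backward theta v u.

(* The edges induced on {v1, v2, v3, v4} are exactly v1v3, v1v4 and v2v4. *)
Definition boat_edges (B : rel H) (v1 v2 v3 v4 : H) : bool :=
  [&& B v1 v3, B v1 v4, B v2 v4, ~~ B v1 v2, ~~ B v2 v3 & ~~ B v3 v4].

Definition left_boat (theta : seq H) (C : {set H}) : Prop :=
  exists v1 v2 v3 v4 : H,
  let pos v := index v theta in
  [/\ C = [set v1; v2; v3; v4],
      [&& pos v1 < pos v2, pos v2 < pos v3 & pos v3 < pos v4],
      pos v3 = pos v2 + 1 /\ pos v3 = pos v1 + 2
    & boat_edges (backedge_graph theta) v1 v2 v3 v4].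

Definition right_boat (theta : seq H) (C : {set H}) : Prop :=
  exists v1 v2 v3 v4 : H,
  let pos v := index v theta in
  [/\ C = [set v1; v2; v3; v4],
      [&& pos v1 < pos v2, pos v2 < pos v3 & pos v3 < pos v4],
      pos v4 = pos v3 + 1 /\ pos v4 = pos v2 + 2
    & boat_edges (backedge_graph theta) v1 v2 v3 v4].

Definition component (B : rel H) (C : {set H}) : Prop :=
  exists v : H, C = [set w | connect B v w].

Definition flotilla : Prop :=
  exists2 theta : seq H, ordering theta &
    forall C : {set H}, component (backedge_graph theta) C ->
      left_boat theta C \/ right_boat theta C.

End Flotilla.

Local Open Scope ring_scope.

(* If T has no vertex then the bound is 0 `^ eps = 0, since eps is nonzero. *)
Definition erdos_hajnal (R : realType) (H : tournament) : Prop :=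
  exists2 eps : R, 0 < eps &
    forall T : tournament, free H T ->
      exists2 S : {set T}, transitive_tournament (subtournament S) &
        #|T|%:R `^ eps <= #|S|%:R.

(* Main.v *)
Require Import Defs.
From mathcomp Require Import all_boot all_order all_algebra.
From mathcomp Require Import reals exp.
From mathcomp Require Import zify.

Set Implicit Arguments.
Unset Strict Implicit.
Unset Printing Implicit Defensive.

(* Write tr S for the largest size of a transitive subset of S. With eps = 1/k,
   the claim for all subsets S of an H-free tournament is #|S| <= (tr S)^k; let
   S be a minimal counterexample. Being H-free, S contains |H| disjoint sets of
   linear size, each almost complete to the later ones, and H is embedded in
   this sequence boat by boat: the three consecutive vertices of a boat go to
   one set A, the fourth one to another set W.

   So one needs w in W and a cyclic triangle in A with exactly two vertices in
   X(w), the set of backward neighbours of w in A. If there is none, then each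
   strong component of X(w) is a module of A. Since A is linear, its modules of
   size at most 3|A|/4 are tiny, hence the maximal ones partition A. The classes
   met by X(w) are then transitively ordered, so their tr add up to at most
   tr S. Call C good if it is met by at most a proportion
   tr C / (2 tr S) of the sets X(w). Double counting bounds the sum of (tr C)^2
   over the bad classes by 2 (tr S)^2, so that their union is small. A maximum
   transitive subset of the union of the good classes misses half of the sets
   X(w), hence is complete to half of W: by minimality of S the union of
   the good classes is small as well, a contradiction. *)

Lemma leq_card_bigcup (I : Type) (T : finType) (r : seq I) (P : pred I)
    (F : I -> {set T}) :
  #|\bigcup_(i <- r | P i) F i| <= \sum_(i <- r | P i) #|F i|.
Proof.
elim/big_rec2: _ => [|i n V _ IH]; first by rewrite cards0.
by apply: leq_trans (leq_card_setU _ _) _; rewrite leq_add2l.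
Qed.

(** * Transitive subsets *)

Section TransitiveSets.
Variable T : tournament.
Implicit Types (x y z : T) (P Q S : {set T}).

Lemma darcN x y : x != y -> darc x y = ~~ darc y x.
Proof. by move=> /(@darc_xor T); case: (darc x y); case: (darc y x). Qed.

Lemma darc_neq x y : darc x y -> x != y.
Proof. by apply: contraTneq => ->; rewrite darc_irr. Qed.

Lemma darc_asym x y : darc x y -> darc y x = false.
Proof. by move=> xy; move: (xy); rewrite darcN ?darc_neq // => /negbTE. Qed.

(** A boolean form of acyclicity, so that [tr] can be a finite maximum; [transitive_subtournament]
    links it to directed cycles. *)
Definition transitive_set P : bool :=
  [forall x in P, forall y in P, forall z in P,
     darc x y ==> (darc y z ==> darc x z)].

Lemma transitive_setP P :
  reflect (forall x y z, x \in P -> y \in P -> z \in P ->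
             darc x y -> darc y z -> darc x z)
          (transitive_set P).
Proof.
apply: (iffP forall_inP) => h => [x y z xP yP zP xy yz|x xP].
  move: (h x xP) => /forall_inP/(_ y yP)/forall_inP/(_ z zP).
  by rewrite xy yz.
apply/forall_inP=> y yP; apply/forall_inP=> z zP.
by apply/implyP=> xy; apply/implyP; apply: h xy.
Qed.

Lemma transitive_set0 : transitive_set set0.
Proof. by apply/transitive_setP=> x y z; rewrite inE. Qed.

Lemma transitive_set2 x y : transitive_set [set x; y].
Proof.
apply/transitive_setP=> a b c; rewrite !inE.
by do 3![case/orP=> /eqP->]; rewrite ?darc_irr // => /darc_asym->.
Qed.

Lemma transitive_setS P Q : P \subset Q -> transitive_set Q -> transitive_set P.
Proof.
move=> /subsetP PQ /transitive_setP tQ; apply/transitive_setP=> x y z xP yP zP.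
by apply: tQ; apply: PQ.
Qed.

Definition tr S := \max_(P : {set T} | (P \subset S) && transitive_set P) #|P|.

Lemma leq_tr P S : P \subset S -> transitive_set P -> #|P| <= tr S.
Proof. by move=> PS tP; apply: (bigop.bigmax_sup P); rewrite ?PS. Qed.

Lemma tr_max S : exists P, [/\ P \subset S, transitive_set P & #|P| = tr S].
Proof.
pose sub P := (P \subset S) && transitive_set P.
have sub0 : sub set0 by rewrite /sub sub0set transitive_set0.
rewrite /tr (@bigop.bigmax_eq_arg _ set0 sub) //;
  case: arg_maxnP => // P /andP[PS tP] _.
by exists P.
Qed.

Lemma tr_le_card S : tr S <= #|S|.
Proof. by have [P [PS _ <-]] := tr_max S; apply: subset_leq_card. Qed.

Lemma tr_gt0 S : 0 < #|S| -> 0 < tr S.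
Proof.
case/card_gt0P=> x xS; have := @leq_tr [set x; x] S; rewrite setUid cards1;
  apply.
  by rewrite sub1set.
by rewrite -[X in transitive_set X]setUid transitive_set2.
Qed.

Lemma tr_gt1 S : 1 < #|S| -> 1 < tr S.
Proof.
case/card_gt1P=> x [y [xS yS xy]]; have := @leq_tr [set x; y] S;
  rewrite cards2 xy; apply.
  by rewrite subUset !sub1set xS.
exact: transitive_set2.
Qed.

(** As there are no loops, maximum transitive subsets of [P] and [Q] are disjoint. No arc leads back
    from [Q] to [P], so their union is transitive. *)
Lemma tr_join P Q S : P \subset S -> Q \subset S ->
  (forall x y, x \in P -> y \in Q -> darc x y) -> tr P + tr Q <= tr S.
Proof.
move=> PS QS PQ; have [P' [P'P tP' <-]] := tr_max P;
  have [Q' [Q'Q tQ' <-]] := tr_max Q.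
have arc x y : x \in P' -> y \in Q' -> darc x y.
  by move=> xP yQ; apply: PQ; [apply: (subsetP P'P) | apply: (subsetP Q'Q)].
have /eqP dis : P' :&: Q' == set0.
  rewrite -subset0; apply/subsetP=> x /setIP[xP xQ]; have := arc x x xP xQ.
  by rewrite darc_irr.
have -> : #|P'| + #|Q'| = #|P' :|: Q'| by rewrite cardsU dis cards0 subn0.
apply: leq_tr.
  by rewrite subUset (subset_trans P'P) ?(subset_trans Q'Q).
move/transitive_setP: tP' => tP'; move/transitive_setP: tQ' => tQ'.
apply/transitive_setP=> x y z.
case/setUP=> xP; case/setUP=> yP; case/setUP=> zP xy yz;
  try by [apply: arc | apply: tP' xy yz | apply: tQ' xy yz].
- by have := arc _ _ zP yP; rewrite (darc_asym yz).
- by have := arc _ _ yP xP; rewrite (darc_asym xy).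
- by have := arc _ _ yP xP; rewrite (darc_asym xy).
- by have := arc _ _ zP yP; rewrite (darc_asym yz).
Qed.

Lemma transitive_subtournament P :
  transitive_set P -> transitive_tournament (subtournament P).
Proof.
move=> /transitive_setP tP [//|x p] _ /andP[/= xp _].
have tr_sub : transitive (@darc (subtournament P)).
  by move=> y u v; apply: tP; apply: valP.
have /allP/(_ x) := order_path_min tr_sub xp.
by rewrite mem_rcons mem_head darc_irr => /(_ isT).
Qed.

End TransitiveSets.

(** Any two distinct vertices span an arc, so a map that preserves arcs is injective and reflects
    arcs. *)
Lemma embedding_contains (H T : tournament) (f : H -> T) :
  (forall u v, darc u v -> darc (f u) (f v)) -> contains T H.
Proof.
move=> fP; have f_inj : injective f.
  move=> u v fuv; apply/eqP; apply/negPn/negP=> uv; have := darc_xor uv.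
  case uv1: (darc u v); first by have := fP _ _ uv1; rewrite fuv darc_irr.
  by move=> /= /fP; rewrite fuv darc_irr.
have fS u : f u \in [set f v | v in H] by apply: imset_f.
exists [set f v | v in H]; exists (fun u => exist _ (f u) (fS u)).
  apply: inj_card_bij; first by move=> u v /(congr1 val) /f_inj.
  by rewrite card_sig (eq_card (B := [set f v | v in H])) ?card_imset.
move=> u v; change (darc (f u) (f v) = darc u v).
have [->|uv] := eqVneq u v; first by rewrite !darc_irr.
case uv1: (darc u v); first by rewrite fP.
have vu : darc v u by rewrite darcN 1?eq_sym // uv1.
by rewrite (darc_asym (fP _ _ vu)).
Qed.

(** * Finding a boat *)

(* [tr_large] and [tr_small] are the only consequences of the minimality of [S]
   that are used; they replace inequalities between real powers of
   cardinalities. [X w] stands for the set of out-neighbours, or of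
   in-neighbours, of [w] in [A]. *)
Section Boat.
Variables (T : tournament) (S A W : {set T}) (X : T -> {set T}) (D : nat).
Implicit Types (x y z w : T) (P Q U C : {set T}).

Hypotheses (AS : A \subset S) (WS : W \subset S).
Hypotheses (cardA : #|S| <= D * #|A|) (cardW : #|S| <= D * #|W|).
Hypothesis t_gt1 : 1 < tr S.
Hypothesis tr_large : forall P, P \subset S ->
  #|S| <= 16 * D * #|P| -> tr S < 2 * tr P.
Hypothesis tr_small : forall P, P \subset S -> 2 * tr P <= tr S ->
  8 * D * #|P| * tr S ^ 2 <= #|S| * tr P ^ 2.
Hypothesis XA : forall w, w \in W -> X w \subset A.
Hypothesis X_half : forall w, w \in W -> 2 * #|X w| <= #|A|.
Hypothesis X_join : forall P Q, P \subset A -> Q \subset W ->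
  (forall p q, p \in P -> q \in Q -> p \notin X q) -> tr P + tr Q <= tr S.
Hypothesis no_boat : forall w x y z, w \in W -> x \in X w -> y \in X w ->
  z \in A -> z \notin X w -> darc x y -> darc y z -> darc z x -> False.

(** * Modules of [A] and the gap in their sizes *)

Definition module U := forall x y z,
  z \in A -> z \notin U -> x \in U -> y \in U -> darc z x = darc z y.

Definition moduleb U := [forall x in U, forall y in U, forall z in A,
  (z \notin U) ==> (darc z x == darc z y)].

Lemma moduleP U : reflect (module U) (moduleb U).
Proof.
apply: (iffP forall_inP) => h => [x y z zA zU xU yU|x xU].
  move: (h x xU) => /forall_inP/(_ y yU)/forall_inP/(_ z zA).
  by rewrite zU => /eqP.
apply/forall_inP=> y yU; apply/forall_inP=> z zA.
by apply/implyP=> zU; apply/eqP; apply: h.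
Qed.

(** Otherwise a singleton would be large enough for [tr_large], forcing [tr S < 2]. *)
Lemma S_large : 16 * D < #|S|.
Proof.
rewrite ltnNge; apply/negP=> le.
have /card_gt0P[x xS] : 0 < #|S| by have := tr_le_card S; lia.
have := @tr_large [set x]; rewrite sub1set cards1 muln1 => /(_ xS le).
by have := tr_le_card [set x]; rewrite cards1; lia.
Qed.

Lemma A_large : 16 < #|A|.
Proof. by have := S_large; have := cardA; nia. Qed.

(** Each vertex of [A] outside [U] dominates all of [U] or is dominated by it. One of the two
    resulting sets [I] and [O] has at least [|A| / 8] vertices, so its [tr] exceeds half of [tr S],
    and joining it to [U] leaves less than half for [tr U]. *)
Lemma small_module_tr U : U \subset A -> module U -> 4 * #|U| <= 3 * #|A| ->
  2 * tr U <= tr S.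
Proof.
move=> UA mU leU.
have [->|/set0Pn[u uU]] := eqVneq U set0.
  by have := tr_le_card (set0 : {set T}); rewrite cards0; lia.
pose I := [set z in A :\: U | darc z u];
  pose O := [set z in A :\: U | ~~ darc z u].
have IA : I \subset S by apply: subset_trans AS; apply/subsetP=> z;
  rewrite !inE => /andP[/andP[]].
have OA : O \subset S by apply: subset_trans AS; apply/subsetP=> z;
  rewrite !inE => /andP[/andP[]].
have cardIO : #|I| + #|O| = #|A| - #|U|.
  rewrite -(cardsDS UA) -(cardsID [set z | darc z u] (A :\: U)).
  by congr (_ + _); apply: eq_card => z; rewrite !inE // andbC.
have US := subset_trans UA AS.
have tIU : tr I + tr U <= tr S.
  apply: tr_join => // z x; rewrite !inE => /andP[/andP[zU zA] zu] xU.
  by rewrite (mU _ u).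
have tUO : tr U + tr O <= tr S.
  apply: tr_join => // x z xU; rewrite !inE => /andP[/andP[zU zA] zu].
  rewrite darcN; first by rewrite (mU _ u).
  by apply: contraNneq zU => <-.
have [leI|ltI] := leqP #|A| (8 * #|I|).
  by have := tr_large IA; have := cardA; nia.
by have := tr_large OA; have := cardA; nia.
Qed.

(** Since [tr U] is at most half of [tr S], [tr_small] gains a factor 4, and 8 becomes 32. This gap
    in the sizes keeps a union of two tiny modules tiny. *)
Lemma small_module U : U \subset A -> module U -> 4 * #|U| <= 3 * #|A| ->
  32 * #|U| <= #|A|.
Proof.
move=> UA mU leU; have US := subset_trans UA AS.
have tU := small_module_tr UA mU leU.
have h := tr_small US tU; have tU2 : 4 * tr U ^ 2 <= tr S ^ 2 by nia.
have t2 : 0 < tr S ^ 2 by rewrite expn_gt0; lia.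
have : 32 * D * #|U| * tr S ^ 2 <= #|S| * tr S ^ 2 by nia.
rewrite leq_pmul2r // => h'; have : D * (32 * #|U|) <= D * #|A| by nia.
by rewrite leq_pmul2l //; have := S_large; nia.
Qed.

(** * The partition of [A] into maximal tiny modules *)

Definition tiny_module x U :=
  [&& x \in U, U \subset A, moduleb U & 32 * #|U| <= #|A|].

Definition class x := [arg max_(U > [set x] | tiny_module x U) #|U|].

Lemma tiny_module1 x : x \in A -> tiny_module x [set x].
Proof.
move=> xA; have mx : module [set x] by move=> a b z _ _ /set1P-> /set1P->.
apply/and4P; split; [exact: set11 | by rewrite sub1set | exact/moduleP | ].
by apply: small_module => //; rewrite ?sub1set // cards1; have := A_large; lia.
Qed.

Lemma class_tiny x : x \in A -> tiny_module x (class x).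
Proof. by move=> xA; rewrite /class; case: arg_maxnP => //;
  apply: tiny_module1. Qed.

Lemma mem_class x : x \in A -> x \in class x.
Proof. by case/class_tiny/and4P. Qed.

Lemma class_sub x : x \in A -> class x \subset A.
Proof. by case/class_tiny/and4P. Qed.

Lemma class_module x : x \in A -> module (class x).
Proof. by case/class_tiny/and4P=> _ _ /moduleP. Qed.

(** Two modules that share [x] have a module as their union. It has at most [|A| / 16] vertices, so
    it is tiny again, and maximality of [class x] absorbs [U]. *)
Lemma class_max x U : x \in A -> x \in U -> U \subset A -> module U ->
  4 * #|U| <= 3 * #|A| -> U \subset class x.
Proof.
move=> xA xU UA mU leU; have leU' := small_module UA mU leU.
have /and4P[xM MA /moduleP mM leM] := class_tiny xA.
have UMA : U :|: class x \subset A by rewrite subUset UA.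
have mUM : module (U :|: class x).
  have h a z : z \in A -> z \notin U :|: class x -> a \in U :|: class x ->
      darc z a = darc z x.
    move=> zA; rewrite inE negb_or => /andP[zU zM] /setUP[aU|aM].
      exact: mU.
    exact: mM.
  by move=> a b z zA zN aN bN; rewrite (h a) // (h b).
have cUM : #|U :|: class x| <= #|U| + #|class x| by rewrite cardsU leq_subr.
have tUM : tiny_module x (U :|: class x).
  apply/and4P; split=> //; first by rewrite inE xU.
    exact/moduleP.
  by apply: small_module => //; have := A_large; lia.
have leUM : #|U :|: class x| <= #|class x|.
  by rewrite {2}/class; case: arg_maxnP => [|V _];
    [apply: tiny_module1 | apply].
have /eqP <- : U :|: class x == class x.
  by rewrite eq_sym eqEcard subsetUr.
exact: subsetUl.
Qed.

Lemma class_eq x y : x \in A -> y \in class x -> class y = class x.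
Proof.
move=> xA yx; have yA := subsetP (class_sub xA) _ yx.
have large z : z \in A -> 4 * #|class z| <= 3 * #|A|.
  by case/class_tiny/and4P=> _ _ _; lia.
have xy : class x \subset class y.
  by apply: class_max => //;
    [apply: class_sub | apply: class_module | apply: large].
apply/eqP; rewrite eqEsubset xy andbT.
apply: class_max => //;
  [| exact: class_sub | exact: class_module | exact: large].
by apply: (subsetP xy); apply: mem_class.
Qed.

Definition classes := [set class x | x in A].

Lemma classesP C x : C \in classes -> x \in C -> [/\ x \in A & C = class x].
Proof.
case/imsetP=> y yA -> xy; split; last by rewrite (class_eq yA xy).
exact: (subsetP (class_sub yA)).
Qed.

Lemma classes_sub C : C \in classes -> C \subset A.
Proof. by case/imsetP=> y yA ->; apply: class_sub. Qed.

(* If [z] had both an in- and an out-neighbour in the strong component of [x]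
   in [X w], some arc of that component would span, with [z], a cyclic triangle
   that makes a boat with [w]. *)
Lemma cyclic_class w x y z : w \in W -> x \in X w -> y \in X w -> z \in X w ->
  darc x y -> darc y z -> darc z x -> class y = class x.
Proof.
have arith a b c : a <= b -> 2 * b <= c -> 4 * a <= 3 * c by lia.
move=> wW xX yX zX xy yz zx; have xA := subsetP (XA wW) _ xX.
pose e := [rel u v | [&& darc u v, u \in X w & v \in X w]].
pose Y := [set v | connect e x v && connect e v x].
have YX : Y \subset X w.
  apply/subsetP=> v; rewrite inE => /andP[_ /connectP[[|u p] /=]].
    by move=> _ <-.
  by case/andP=> /and3P[].
have xY : x \in Y by rewrite inE !connect0.
have yY : y \in Y.
  rewrite inE connect1 /=; last by rewrite xy xX.
  by apply: (@connect_trans _ _ z); apply: connect1; rewrite /= ?yz ?zx ?yX ?zX.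
have YA : Y \subset A by apply: subset_trans YX _; apply: XA.
have leY : 4 * #|Y| <= 3 * #|A|.
  by apply: arith (subset_leq_card YX) (X_half wW).
suff mY : module Y by apply: (class_eq xA);
  apply: (subsetP (class_max xA xY YA mY leY)).
suff h a b v : v \in A -> v \notin Y -> a \in Y -> b \in Y -> darc v a ->
  darc v b.
  by move=> a b v vA vY aY bY; apply/idP/idP; apply: h.
move=> vA vY aY bY va; apply/negPn/negP=> nvb.
have bv : darc b v.
  by rewrite darcN //; apply: contraNneq vY => <-.
have aX := subsetP YX _ aY; have bX := subsetP YX _ bY.
move: aY bY; rewrite !inE => /andP[xa ax] /andP[xb bx].
(* If [v] is in [X w], the arcs from [b] to [v] and from [v] to [a] put it in the strong component
   [Y]. *)
have [vX|vX] := boolP (v \in X w).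
  case/negP: vY; rewrite inE; apply/andP; split.
    by apply: connect_trans xb (connect1 _); rewrite /= bv bX.
  by apply: connect_trans (connect1 _) ax; rewrite /= va vX.
have /connectP[p ep lp] : connect e a b by apply: connect_trans ax xb.
have step u u' : e u u' -> darc v u -> darc v u'.
  case/and3P=> uu' uX uX' vu; apply/negPn/negP=> nvu'.
  apply: (no_boat wW uX uX' vA vX uu' _ vu).
  by rewrite darcN //; apply: contraNneq vX => <-.
case/negP: nvb; rewrite lp {lp}.
elim: p a va ep {xa ax aX} => //= u p IH a va /andP[au ep].
by apply: IH => //; apply: step va.
Qed.

Lemma class_arc C C' x x' y y' : C \in classes -> C' \in classes -> C != C' ->
  x \in C -> x' \in C -> y \in C' -> y' \in C' -> darc x y = darc x' y'.
Proof.
move=> CM CM' CC' xC xC' yC yC'.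
have dis z : z \in C -> z \in C' -> False.
  move=> zC zC'; case/eqP: CC'.
  by have [_ ->] := classesP CM zC; have [_ ->] := classesP CM' zC'.
have [xA eC] := classesP CM xC; have [yA eC'] := classesP CM' yC.
have [xA' _] := classesP CM xC'; have [yA' _] := classesP CM' yC'.
have mC := class_module xA; have mC' := class_module yA.
rewrite -eC in mC; rewrite -eC' in mC'.
rewrite (mC' y y' x) //; last by apply/negP=> /(dis _ xC).
have ne u : u \in C -> u != y' by move=> uC; apply: contraTneq yC' => <-;
  apply/negP/dis.
rewrite (darcN (ne x xC)) (darcN (ne x' xC')) (mC x x' y') //.
by apply/negP=> /dis /(_ yC').
Qed.

(** Maximum transitive subsets of the classes in [J] have a transitive union, because arcs between
    distinct classes agree with those between the representatives [g C]. *)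
Lemma sum_tr_classes (J : {set {set T}}) (g : {set T} -> T) :
  J \subset classes -> (forall C, C \in J -> g C \in C) ->
  transitive_set (g @: J) -> \sum_(C in J) tr C <= tr S.
Proof.
move=> /subsetP JM gC /transitive_setP tJ.
have [pk pkP] := fin_all_exists (fun C : {set T} => tr_max C).
pose Q := \bigcup_(C in J) pk C.
have pkC C x : x \in pk C -> x \in C by have [/subsetP h _ _] := pkP C;
  apply: h.
have inQ x : x \in Q -> exists C, [/\ C \in J, x \in C & x \in pk C].
  by case/bigcupP=> C CJ xC; exists C; split=> //; apply: pkC.
have tQ : transitive_set Q.
  apply/transitive_setP=> x y z /inQ[C1 [J1 x1 x1']] /inQ[C2 [J2 y2 y2']]
    /inQ[C3 [J3 z3 z3']] xy yz.
  have arc C C' u u' v v' := @class_arc C C' u u' v v'.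
  have [e12|n12] := eqVneq C1 C2.
    subst C2; have [e13|n13] := eqVneq C1 C3.
      subst C3; have [_ /transitive_setP tC _] := pkP C1.
      exact: tC xy yz.
    by rewrite (arc C1 C3 x y z z) ?JM.
  have [e23|n23] := eqVneq C2 C3.
    by subst C3; rewrite (arc C1 C2 x x z y) ?JM.
  have [e13|n13] := eqVneq C1 C3.
    subst C3; move: xy; rewrite (arc C1 C2 x z y y) ?JM //.
    by rewrite (darc_asym yz).
  rewrite (arc C1 C3 x (g C1) z (g C3)) ?JM ?gC //.
  apply: (tJ (g C1) (g C2)); rewrite ?imset_f //.
    by rewrite -(arc C1 C2 x (g C1) y (g C2)) ?JM ?gC.
  by rewrite -(arc C2 C3 y (g C2) z (g C3)) ?JM ?gC.
have QS : Q \subset S.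
  apply/subsetP=> x /inQ[C [CJ xC _]]; apply: (subsetP AS).
  by apply: (subsetP (classes_sub (JM _ CJ))).
apply: leq_trans (leq_tr QS tQ).
have -> : \sum_(C in J) tr C = \sum_(C in J) \sum_(x in Q | x \in pk C) 1.
  apply: eq_bigr => C CJ; have [_ _ <-] := pkP C; rewrite sum1dep_card.
  apply: eq_card => x; rewrite !inE; case xC: (x \in pk C);
    last by rewrite andbF.
  by rewrite andbT; symmetry; apply/bigcupP; exists C.
(* Classes are disjoint, so each vertex of [Q] is counted at most once. *)
rewrite (exchange_big_dep (mem Q)) /=; last by move=> C x _ /andP[].
rewrite -sum1_card; apply: leq_sum => x xQ.
rewrite sum1dep_card leqNgt; apply/negP=> /card_gt1P[C [C' []]].
rewrite !inE => /andP[CJ /andP[_ xC]] /andP[CJ' /andP[_ xC']] /eqP; apply.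
have [_ ->] := classesP (JM _ CJ) (pkC _ _ xC).
by have [_ ->] := classesP (JM _ CJ') (pkC _ _ xC').
Qed.

(** * Good and bad classes *)

Definition touching C := [set w in W | X w :&: C != set0].

(** The representatives are taken in [X w]. A cyclic triangle among them would, by [cyclic_class],
    put two of them in the same class; hence they form a transitive set. *)
Lemma sum_tr_touched w : w \in W ->
  \sum_(C in classes | w \in touching C) tr C <= tr S.
Proof.
move=> wW; pose J := [set C in classes | w \in touching C].
have -> : \sum_(C in classes | w \in touching C) tr C = \sum_(C in J) tr C.
  by apply: eq_bigl => C; rewrite !inE.
pose g C := odflt w [pick x in X w :&: C].
have gP C : C \in J -> g C \in X w :&: C.
  rewrite 2!inE => /andP[_ /andP[_ /set0Pn[x xC]]].
  by rewrite /g; case: pickP => [y|/(_ x)] //; rewrite xC.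
apply: (@sum_tr_classes J g) => [|C CJ|].
- by apply/subsetP=> C; rewrite inE => /andP[].
- by have /setIP[] := gP C CJ.
apply/transitive_setP=> _ _ _ /imsetP[C1 J1 ->] /imsetP[C2 J2 ->]
  /imsetP[C3 J3 ->] a12 a23.
have [/setIP[x1 c1] /setIP[x2 c2]] := (gP _ J1, gP _ J2).
have /setIP[x3 c3] := gP _ J3.
apply/negPn/negP=> n13.
have a31 : darc (g C3) (g C1).
  rewrite darcN //; apply: contraTneq a12 => <-; by rewrite (darc_asym a23).
have M C : C \in J -> C \in classes by rewrite inE => /andP[].
have e12 : C1 = C2.
  have [_ ->] := classesP (M _ J1) c1; have [_ ->] := classesP (M _ J2) c2.
  by rewrite (cyclic_class wW x1 x2 x3 a12 a23 a31).
by move: a12; rewrite e12 darc_irr.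
Qed.

Lemma sum_tr_touching :
  \sum_(C in classes) tr C * #|touching C| <= #|W| * tr S.
Proof.
have -> : \sum_(C in classes) tr C * #|touching C| =
    \sum_(C in classes) \sum_(w in W | w \in touching C) tr C.
  apply: eq_bigr => C _; rewrite -sum1_card big_distrr /=.
  by apply: eq_big => w; rewrite ?muln1 // !inE; case: (w \in W).
rewrite (exchange_big_dep (mem W)) /=; last by move=> C w _ /andP[].
rewrite -sum_nat_const; apply: leq_sum => w wW.
by under eq_bigl => C do rewrite wW /=; apply: sum_tr_touched.
Qed.

(* By [tr_small], #|C| is at most a tiny multiple of (tr C)^2, so it suffices to
   bound the sum of these squares over the bad classes. *)
Definition bad_classes :=
  [set C in classes | #|W| * tr C < 2 * tr S * #|touching C|].
Definition good_part := \bigcup_(C in classes :\: bad_classes) C.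

Lemma bad_classes_card : 4 * \sum_(C in bad_classes) #|C| <= #|A|.
Proof.
have badM C : C \in bad_classes -> C \in classes by rewrite inE => /andP[].
have W_gt0 : 0 < #|W| by have := S_large; have := cardW; nia.
(* The inequality defining badness is multiplied by [tr C] and summed; [sum_tr_touching] bounds the
   result, and [#|W|] cancels. *)
have h1 : \sum_(C in bad_classes) tr C ^ 2 <= 2 * tr S ^ 2.
  rewrite -(leq_pmul2l W_gt0) big_distrr /=.
  apply: leq_trans (_ : 2 * tr S * \sum_(C in classes) tr C * #|touching C| <=
    _).
    rewrite big_distrr /= [X in _ <= X](bigID (mem bad_classes)) /=.
    apply: leq_trans (leq_addr _ _).
    rewrite [X in _ <= X](eq_bigl (mem bad_classes)) => [|C].
      by apply: leq_sum => C; rewrite inE => /andP[_]; nia.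
    by case h: (C \in bad_classes); rewrite ?andbF // badM.
  by have := sum_tr_touching; nia.
have h2 : 8 * D * (\sum_(C in bad_classes) #|C|) * tr S ^ 2 <=
    #|S| * \sum_(C in bad_classes) tr C ^ 2.
  rewrite !big_distrr /= big_distrl /= leq_sum // => C /badM CM.
  have CA := classes_sub CM; apply: tr_small; first exact: subset_trans CA AS.
  have /imsetP[x xA eC] := CM.
  have /and4P[_ _ /moduleP mC leC] := class_tiny xA; rewrite -eC in mC leC.
  by apply: small_module_tr => //; lia.
have t2 : 0 < tr S ^ 2 by rewrite expn_gt0; lia.
have h3 : 8 * D * (\sum_(C in bad_classes) #|C|) * tr S ^ 2 <= 2 * #|S| * tr S
  ^ 2 by nia.
rewrite leq_pmul2r // in h3.
have h4 : D * (4 * \sum_(C in bad_classes) #|C|) <= D * #|A| by nia.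
by rewrite leq_pmul2l // in h4; have := S_large; nia.
Qed.

(** Otherwise a maximum transitive subset [P] of the good part has more than [tr S / 2] vertices.
    The classes it meets have total [tr] at most [tr S], so by goodness their [touching] sets cover
    at most half of [W]. The remaining [w] form a set [W'] with [tr] above half of [tr S], and
    joining it to [P] exceeds [tr S]. *)
Lemma good_part_card : 2 * #|good_part| < #|A|.
Proof.
have arith (t m a b : nat) : 1 < t -> a <= t -> 2 * t * b <= m * a ->
  2 * b <= m.
  move=> t1 le_a le_b; have : t * (2 * b) <= t * m by nia.
  by rewrite leq_pmul2l //; lia.
have goodA : good_part \subset A.
  by apply/bigcupsP=> C /setDP[CM _]; apply: classes_sub.
have goodS := subset_trans goodA AS.
rewrite ltnNge; apply/negP=> le.
have t_good : tr S < 2 * tr good_part by apply: tr_large => //; have := cardA;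
  nia.
have [P [Pgood tP cP]] := tr_max good_part.
pose J := [set C in classes | P :&: C != set0].
(* Outside [J] the value is an arbitrary vertex of [A]. *)
pose g C := odflt (xchoose (card_gt0P (ltn_trans (ltn0Sn _) A_large))) [pick x
  in P :&: C].
have gP C : C \in J -> g C \in P :&: C.
  rewrite inE => /andP[_ /set0Pn[x xC]].
  by rewrite /g; case: pickP => [y|/(_ x)] //; rewrite xC.
have sumJ : \sum_(C in J) tr C <= tr S.
  apply: (@sum_tr_classes J g) => [|C CJ|].
  - by apply/subsetP=> C; rewrite inE => /andP[].
  - by have /setIP[] := gP C CJ.
  apply: transitive_setS tP; apply/subsetP=> _ /imsetP[C CJ ->].
  by have /setIP[] := gP C CJ.
have Jgood C : C \in J -> 2 * tr S * #|touching C| <= #|W| * tr C.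
  rewrite inE => /andP[CM /set0Pn[x /setIP[xP xC]]].
  have /bigcupP[C' /setDP[CM' nbad] xC'] := subsetP Pgood x xP.
  have [_ eC] := classesP CM xC; have [_ eC'] := classesP CM' xC'.
  by move: nbad; rewrite eC' -eC inE CM /= -leqNgt.
have sum_touch : 2 * \sum_(C in J) #|touching C| <= #|W|.
  have : 2 * tr S * \sum_(C in J) #|touching C| <= #|W| * \sum_(C in J) tr C.
    move: (2 * tr S) Jgood => u Jgood.
    by rewrite !big_distrr /=; apply: leq_sum => C CJ; apply: Jgood.
  exact: (arith _ _ _ _ t_gt1 sumJ).
pose W' := [set w in W | [disjoint P & X w]].
have W'W : W' \subset W by apply/subsetP=> w; rewrite inE => /andP[].
have leW : #|W| <= #|W'| + \sum_(C in J) #|touching C|.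
  have sub : W \subset W' :|: \bigcup_(C in J) touching C.
    apply/subsetP=> w wW; rewrite !inE wW /=;
      have [//|] := boolP [disjoint P & X w].
    case/pred0Pn=> x /andP[/= xP xw].
    have /bigcupP[C /setDP[CM _] xC] := subsetP Pgood x xP.
    apply/bigcupP; exists C; rewrite !inE ?CM ?wW /=; apply/set0Pn; exists x;
      by rewrite inE ?xP ?xw.
  apply: leq_trans (subset_leq_card sub) _.
  apply: leq_trans (leq_card_setU _ _) _.
  by rewrite leq_add2l leq_card_bigcup.
have t_W' : tr S < 2 * tr W'.
  by apply: tr_large; [apply: subset_trans WS | have := cardW; nia].
have t_P : tr P + tr W' <= tr S.
  apply: X_join => //; first exact: subset_trans goodA.
  move=> p q pP; rewrite inE => /andP[_ dis]; apply/negP=> pX.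
  by rewrite (disjointFr dis pP) in pX.
by have := leq_tr (subxx P) tP; lia.
Qed.

(** The classes cover [A], but the good ones fill less than half of it and the bad ones at most a
    quarter. *)
Lemma boat_absurd : False.
Proof.
have := bad_classes_card; have := good_part_card.
suff : #|A| <= #|good_part| + \sum_(C in bad_classes) #|C| by have := A_large;
  lia.
have sub : A \subset good_part :|: \bigcup_(C in bad_classes) C.
  apply/subsetP=> x xA; have CM : class x \in classes by apply: imset_f.
  rewrite inE; have [bad|good] := boolP (class x \in bad_classes); apply/orP.
    by right; apply/bigcupP; exists (class x); last exact: mem_class.
  left; apply/bigcupP; exists (class x); last exact: mem_class.
  by rewrite !inE CM andbT; rewrite inE CM in good.
apply: leq_trans (subset_leq_card sub) _.
apply: leq_trans (leq_card_setU _ _) _.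
by rewrite leq_add2l leq_card_bigcup.
Qed.

End Boat.

(** * Almost transitive sequences of sets *)

(* The flag reverses all arcs: it treats left and right boats, whose isolated
   vertex lies after, respectively before, the other three, at once. *)
Definition garc (T : tournament) (b : bool) (x y : T) :=
  if b then darc x y else darc y x.

Definition nonarcs (T : tournament) (A B : {set T}) :=
  \sum_(a in A) #|[set b in B | ~~ darc a b]|.

Lemma nonarcsC (T : tournament) (A B : {set T}) :
  nonarcs A B = \sum_(b in B) #|[set a in A | ~~ darc a b]|.
Proof.
rewrite /nonarcs.
under eq_bigr => a _ do rewrite -sum1dep_card.
under [RHS]eq_bigr => a _ do rewrite -sum1dep_card.
rewrite (exchange_big_dep (mem B)) /=; last by move=> a b _ /andP[].
apply: eq_bigr => b bB; apply: eq_bigl => a.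
by rewrite bB.
Qed.

Lemma nonarcsS (T : tournament) (A B C : {set T}) : C \subset B ->
  nonarcs A C <= nonarcs A B.
Proof.
move=> CB; apply: leq_sum => a _; apply: subset_leq_card.
by apply/subsetP=> b; rewrite !inE => /andP[/(subsetP CB)-> ->].
Qed.

Lemma pigeonhole_sum (I : eqType) (r : seq I) (F : I -> nat) n :
  0 < n -> n <= \sum_(i <- r) F i -> exists2 i, i \in r & n <= size r * F i.
Proof.
(* The factor [k] stays fixed while [s] varies in the induction; it is later set to [size r]. *)
have gen k s : (forall i, i \in s -> k * F i < n) ->
  k * \sum_(i <- s) F i + size s <= size s * n.
  elim: s => [|i s IH] lt; first by rewrite big_nil muln0.
  have := lt i (mem_head _ _);
    have := IH (fun j js => lt j (@mem_behead _ (i :: s) j js)).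
  by rewrite big_cons /= mulnDr mulSn; lia.
move=> n_gt0 le; have [/hasP[i ir le_i]|/hasPn lt] :=
  boolP (has (fun i => n <= size r * F i) r).
  by exists i.
have : size r * \sum_(i <- r) F i + size r <= size r * n.
  by apply: gen => i /lt /=; rewrite -ltnNge.
by case: (r) le => [|i s] /=;
  [rewrite big_nil | move: (\sum_(_ <- _) _) => m]; nia.
Qed.

Section Pair.
Variable H : tournament.

Definition few (T : tournament) L (b : bool) (A B : {set T}) :=
  forall a, a \in A -> L * #|[set x in B | garc b a x]| < #|B|.

(* Greedy embedding: each image is chosen so as to leave a proportion [1 / L] of
   every later candidate set; when this is impossible, at least one choice in
   [size r] fails for one and the same later set. *)
Lemma embed_or_few (r : seq H) (L D : nat) : uniq r ->
  exists D', forall (T : tournament) (S : {set T})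
    (V : H -> {set T}), 0 < #|S| ->
  (forall v, v \in r -> V v \subset S /\ #|S| <= D * #|V v|) ->
  (exists f : H -> T, (forall v, v \in r -> f v \in V v) /\
      (forall u v, u \in r -> v \in r -> darc u v -> darc (f u) (f v))) \/
  exists (A B : {set T}) b, [/\ A \subset S, B \subset S, #|S| <= D' * #|A|,
    #|S| <= D' * #|B|
     & few L b A B].
Proof.
elim: r D => [|v r IH] D /=.
  move=> _; exists 0 => T S V /card_gt0P[x _] _; left.
  by exists (fun=> x); split.
(* One choice may shrink each later candidate set by a factor [L]. *)
case/andP=> vr /(IH (L * D)) [D' D'P].
(* By pigeonhole, the choices that fail for one single [u] make up at least a share [1 / size r] of
   [V v]. *)
exists (maxn D' (D * size r)) => T S V S_gt0 hV.
have [VvS cVv] := hV v (mem_head _ _).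
have hVr u : u \in r -> V u \subset S /\ #|S| <= D * #|V u|.
  by move=> ur; apply: hV; rewrite inE ur orbT.
pose N a u := [set x in V u | garc (darc v u) a x].
have [/existsP[a /andP[aV /allP aN]]|none] :=
    boolP [exists a, (a \in V v) && all (fun u => #|V u| <= L * #|N a u|) r].
  have [u ur|[f [fV fP]]|[A [B [b [AS BS cA cB fAB]]]]] := D'P T S (N a) S_gt0.
  - have [VuS cVu] := hVr u ur; split.
      by apply: subset_trans VuS; apply/subsetP=> x; rewrite inE => /andP[].
    by have := aN u ur; nia.
  - left; exists (fun u => if u == v then a else f u); split.
      move=> u; rewrite inE; case: eqP => [-> //|_ /= ur].
      by have := fV u ur; rewrite inE => /andP[].
    move=> u w; rewrite !inE; case: eqP => [->|_] /=; case: eqP => [->|_] //=.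
    + by rewrite darc_irr.
    + by move=> _ wr vw; have := fV w wr; rewrite inE /garc vw => /andP[].
    + move=> ur _ uv; have := fV u ur.
      by rewrite inE /garc (darc_asym uv) => /andP[].
    + exact: fP.
  - right; exists A, B, b; split=> //;
      [apply: leq_trans cA _|apply: leq_trans cB _];
      by rewrite leq_mul2r leq_maxl orbT.
pose bad u := [set a in V v | L * #|N a u| < #|V u|].
have sub : V v \subset \bigcup_(u <- r) bad u.
  apply/subsetP=> a aV; move/existsPn: none => /(_ a); rewrite aV /= -has_predC.
  case/hasP=> u ur /= lt; rewrite (big_rem u) //= inE; apply/orP; left.
  by rewrite inE aV /= ltnNge.
have [u ur le_u] : exists2 u, u \in r & #|V v| <= size r * #|bad u|.
  have Vv0 : 0 < #|V v| by nia.
  have : #|V v| <= \sum_(u <- r) #|bad u|.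
    exact: leq_trans (subset_leq_card sub) (leq_card_bigcup _ _ _).
  exact: pigeonhole_sum.
have [VuS cVu] := hVr u ur.
right; exists (bad u), (V u), (darc v u); split=> //.
- by apply: subset_trans VvS; apply/subsetP=> x; rewrite inE => /andP[].
- apply: leq_trans cVv (leq_trans _ (leq_mul (leq_maxr _ _) (leqnn _))).
  by rewrite -mulnA leq_mul.
- apply: leq_trans cVu _; apply: leq_mul => //.
  apply: leq_trans (leq_maxr _ _); case: (r) ur => // w s _;
    rewrite leq_pmulr //.
by move=> a; rewrite inE => /andP[].
Qed.

(** [A1] takes as many vertices of [A] as possible, up to half of [#|B|], and [B1] is the rest of
    [B]. The 3 absorbs the rounding in the half. *)
Lemma disjoint_halves (T : finType) (A B : {set T}) : 1 < #|B| ->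
  exists A1 B1 : {set T}, [/\ A1 \subset A, B1 \subset B, [disjoint A1 & B1],
    minn #|A| #|B| <= 3 * #|A1| & #|B| <= 2 * #|B1|].
Proof.
move=> B_gt1; pose k := minn #|A| #|B|./2.
pose A1 := [set x in take k (enum A)].
have A1A : A1 \subset A.
  by apply/subsetP=> x; rewrite inE => /mem_take; rewrite mem_enum.
have cA1 : #|A1| = k.
  rewrite cardsE; have /card_uniqP -> := take_uniq k (enum_uniq A).
  by rewrite size_takel // -cardE geq_minl.
exists A1, (B :\: A1); split=> //; first exact: subsetDl.
- by rewrite disjoint_sym disjoints_subset subsetDr.
- by rewrite cA1 /k; lia.
have : #|B| - #|A1| <= #|B :\: A1|.
  by rewrite cardsD leq_sub2l // subset_leq_card // subsetIr.
by rewrite cA1 /k; lia.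
Qed.

(** [H]-freeness rules out the embedding in [embed_or_few]. Disjoint sets with few arcs one way are
    almost complete the other way; [2 * L] compensates for halving [B0]. *)
Lemma dense_pair (L : nat) : exists D, forall (T : tournament) (S : {set T}),
    ~ contains T H -> D <= #|S| ->
  exists A B : {set T}, [/\ A \subset S, B \subset S, #|S| <= D * #|A|, #|S| <=
    D * #|B|
     & [disjoint A & B] && (L * nonarcs A B <= #|A| * #|B|)].
Proof.
have [D0 D0P] := embed_or_few (2 * L) 1 (enum_uniq H).
exists (3 * D0).+1 => T S Hfree le_S.
have [|v _|[f [_ fP]]|[A0 [B0 [b [AS0 BS0 cA0 cB0 fAB0]]]]] :=
  D0P T S (fun=> S); first by lia.
- by rewrite mul1n.
- case: Hfree; apply: (@embedding_contains H T f) => u v.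
  by apply: fP; rewrite mem_enum.
have [|A [B [AA0 BB0 dis cA1 cB1]]] := @disjoint_halves T A0 B0; first by nia.
have AS := subset_trans AA0 AS0; have BS := subset_trans BB0 BS0.
have [cA cB] : #|S| <= (3 * D0).+1 * #|A| /\ #|S| <= (3 * D0).+1 * #|B|.
  split; last by nia.
  apply: leq_trans (_ : D0 * minn #|A0| #|B0| <= _); last by nia.
  by rewrite /minn; case: ifP.
have key : L * \sum_(a in A) #|[set x in B | ~~ garc (~~ b) a x]| <= #|A| *
  #|B|.
  rewrite big_distrr -sum_nat_const /=; apply: leq_sum => a aA.
  suff : #|[set x in B | ~~ garc (~~ b) a x]| <= #|[set x in B0 | garc b a x]|.
    by have := fAB0 a (subsetP AA0 _ aA); nia.
  apply: subset_leq_card; apply/subsetP=> x; rewrite !inE => /andP[xB].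
  have xa : x != a by apply: contraTneq aA => <-; rewrite (disjointFl dis xB).
  rewrite (subsetP BB0 _ xB) /garc; case: (b) => /=.
    by rewrite (darcN xa) negbK.
  by rewrite (darcN xa).
(* If few arcs lead from [A] to [B], then [B] must come first. *)
case: b fAB0 key => _ key.
  exists B, A; split=> //.
  by rewrite disjoint_sym dis nonarcsC [X in _ <= X]mulnC.
by exists A, B; rewrite dis.
Qed.

(** The recursion continues inside the second set of a dense pair. Passing to a share [1 / D] of [B]
    can multiply the density of non-arcs by [D], hence [L * D]. *)
Lemma dense_sequence (L m : nat) : exists D N, forall (T : tournament) (S :
  {set T}),
    ~ contains T H -> N <= #|S| ->
  exists s : seq {set T}, [/\ size s = m,
     (forall A, A \in s -> A \subset S /\ #|S| <= D * #|A|) &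
     pairwise (fun A B : {set T} =>
       [disjoint A & B] && (L * nonarcs A B <= #|A| * #|B|)) s].
Proof.
elim: m => [|m [D [N IH]]].
  by exists 0, 0 => T S _ _; exists [::].
have [D' D'P] := dense_pair (L * D).
exists (D' * (D + 1)), (D' * N.+1).+1 => T S Hfree le_S.
have [|A [B [AS BS cA cB /andP[dis AB]]]] := D'P T S Hfree; first by nia.
have B_large : N < #|B|.
  have : D' * N.+1 < D' * #|B| by apply: leq_trans cB.
  by rewrite ltn_mul2l => /andP[_ /ltnW].
have [|s [sz sP ps]] := IH T B Hfree; first exact: ltnW.
exists (A :: s); split => /=; first by rewrite sz.
  move=> C; rewrite inE => /predU1P[->|/sP[CB cC]]; split=> //.
  - by nia.
  - exact: subset_trans BS.
  by nia.
rewrite ps andbT; apply/allP=> C /sP[CB cC]; rewrite (disjointWr CB dis) /=.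
have D_gt0 : 0 < D by nia.
rewrite -(leq_pmul2l D_gt0).
apply: leq_trans (_ : L * D * nonarcs A B <= _).
  by rewrite mulnCA mulnA leq_mul2l nonarcsS ?orbT.
by apply: leq_trans AB _; rewrite mulnCA leq_mul2l cC orbT.
Qed.

(** Average bounds become bounds at every vertex by discarding from each [B i] the vertices with too
    many wrong arcs to some [B k]. In [4 * L * m], the factor [2 * m] keeps the discarded vertices
    within half of [B i], and [2 * L] drops to [L] because [A k] may be only half of [B k]. *)
Lemma smooth_sequence (L m : nat) : exists D N, forall (T : tournament) (S :
  {set T}),
    ~ contains T H -> N <= #|S| ->
  exists A : nat -> {set T},
    (forall i, i < m -> A i \subset S /\ #|S| <= D * #|A i|) /\
    (forall i k, i < m -> k < m -> i != k -> [disjoint A i & A k] /\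
      forall x, x \in A i -> L * #|[set a in A k | ~~ garc (i < k) x a]| <= #|A
        k|).
Proof.
have [D [N DNP]] := dense_sequence (4 * L * m) m.
exists (D * 2), N.+1 => T S Hfree le_S.
have [|s [sz sP /(pairwiseP set0) ps]] := DNP T S Hfree; first exact: ltnW.
pose B i := nth set0 s i.
have BP i : i < m -> B i \subset S /\ #|S| <= D * #|B i|.
  by move=> im; apply: sP; rewrite mem_nth ?sz.
pose bad i k x := [set a in B k | ~~ garc (i < k) x a].
have pairP i k : i < m -> k < m -> i != k -> [disjoint B i & B k] /\
    4 * L * m * \sum_(x in B i) #|bad i k x| <= #|B i| * #|B k|.
  move=> im km; rewrite neq_ltn => /orP[ik|ki].
    have := ps i k; rewrite !inE sz => /(_ im km ik)/andP[-> le]; split=> //.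
    by rewrite /bad ik.
  have := ps k i; rewrite !inE sz => /(_ km im ki)/andP[dis le].
  rewrite disjoint_sym dis; split=> //.
  have -> : (\sum_(x in B i) #|bad i k x|) = nonarcs (B k) (B i).
    by rewrite nonarcsC; apply: eq_bigr => x _; rewrite /bad ltnNge ltnW.
  by rewrite [X in _ <= X]mulnC.
pose A i := [set x in B i | [forall k :
  'I_m, (i != k) ==> (2 * L * #|bad i k x| <= #|B k|)]].
have AB i : A i \subset B i by apply/subsetP=> x; rewrite inE => /andP[].
have cA i : i < m -> #|B i| <= 2 * #|A i|.
  move=> im; pose R (k : 'I_m) :=
    [set x in B i | (i != k) && (#|B k| < 2 * L * #|bad i k x|)].
  (* Markov's inequality for the number of wrong arcs from a vertex of [B i] to [B k]. *)
  have cR k : 2 * m * #|R k| <= #|B i|.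
    have [ik|ik] := eqVneq i k.
      rewrite [R k](_ : _ = set0) ?cards0 ?muln0 //.
      by apply/setP=> x; rewrite !inE ik eqxx andbF.
    have [_ le] := pairP i k im (ltn_ord k) ik.
    have [_ cB] := BP k (ltn_ord k).
    have B_gt0 : 0 < #|B k| by nia.
    have leR : #|R k| * #|B k| <= 2 * L * \sum_(x in B i) #|bad i k x|.
      rewrite big_distrr /= [X in _ <= X](bigID (mem (R k))) /=.
      apply: leq_trans (leq_addr _ _); rewrite -sum_nat_const.
      rewrite [X in _ <= X](eq_bigl (mem (R k))) => [|x].
        by apply: leq_sum => x; rewrite inE => /and3P[_ _ /ltnW].
      by rewrite !inE; case: (x \in B i).
    by rewrite -(leq_pmul2r B_gt0); nia.
  have sub : B i \subset A i :|: \bigcup_k R k.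
    apply/subsetP=> x xB; rewrite inE; have [//|] := boolP (x \in A i).
    rewrite inE xB negb_forall => /existsP[k];
      rewrite negb_imply -ltnNge => /andP[ik lt].
    by apply/bigcupP; exists k => //; rewrite inE xB ik.
  have leB : #|B i| <= #|A i| + \sum_k #|R k|.
    apply: leq_trans (subset_leq_card sub) _.
    apply: leq_trans (leq_card_setU _ _) _.
    by rewrite leq_add2l leq_card_bigcup.
  have : 2 * m * \sum_k #|R k| <= m * #|B i|.
    rewrite big_distrr /= -[m in m * #|B i|]card_ord -sum_nat_const.
    by apply: leq_sum => k _; apply: cR.
  by move: (\sum_k _) leB => r; nia.
exists A; split=> [i im|i k im km ik].
  have [BS cB] := BP i im; split; first exact: subset_trans BS.
  by have := cA i im; nia.
have [dis _] := pairP i k im km ik; split; first exact: disjointW dis.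
move=> x; rewrite inE => /andP[_ /forallP/(_ (Ordinal km))];
  rewrite /= ik /= => le.
have : #|[set a in A k | ~~ garc (i < k) x a]| <= #|bad i k x|.
  apply: subset_leq_card; apply/subsetP=> a.
  by rewrite !inE => /andP[/andP[-> _] ->].
by have := cA k km; nia.
Qed.

End Pair.

(** * Embedding a flotilla *)

Lemma garc_asym (T : tournament) b (x y : T) : garc b x y -> garc b y x = false.
Proof. by case: b => /darc_asym. Qed.

Lemma garcN (T : tournament) b (x y : T) : x != y -> garc b x y = ~~ garc b y x.
Proof. by rewrite /garc; case: b => xy; rewrite darcN // eq_sym. Qed.

(** The absence of a boat contradicts [boat_absurd], with [X w] the neighbours of [w] in direction
    [b]; the flag only decides which of [P] and [Q] comes first in a join. *)
Lemma boat_exists (T : tournament) (S A W : {set T}) (b : bool) (D : nat) :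
  A \subset S -> W \subset S -> [disjoint A & W] ->
  #|S| <= D * #|A| -> #|S| <= D * #|W| -> 1 < tr S ->
  (forall P : {set T}, P \subset S -> #|S| <= 16 * D * #|P| ->
    tr S < 2 * tr P) ->
  (forall P : {set T}, P \subset S -> 2 * tr P <= tr S ->
     8 * D * #|P| * tr S ^ 2 <= #|S| * tr P ^ 2) ->
  (forall w, w \in W -> 2 * #|[set a in A | garc b w a]| <= #|A|) ->
  exists x y z w, [/\ x \in A, y \in A, z \in A & w \in W] /\
    [/\ darc x y, darc y z & darc z x] /\
      [/\ garc b w x, garc b w y & garc b z w].
Proof.
move=> AS WS dis cA cW t1 large small half.
pose X w := [set a in A | garc b w a].
pose boat := [exists x in A, exists y in A, exists z in A, exists w in W,
  [&& darc x y, darc y z, darc z x, garc b w x, garc b w y & garc b z w]].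
have [|no] := boolP boat.
  case/exists_inP=> x xA /exists_inP[y yA] /exists_inP[z zA] /exists_inP[w wW].
  by case/and5P=> ? ? ? ? /andP[? ?]; exists x, y, z, w.
have neq p q : p \in A -> q \in W -> p != q.
  by move=> pA qW; apply: contraTneq pA => ->; rewrite (disjointFl dis qW).
exfalso; apply: (@boat_absurd T S A W X D) => //.
- by move=> w _; apply/subsetP=> a; rewrite inE => /andP[].
- move=> P Q PA QW PQ; have arc p q : p \in P -> q \in Q -> garc b p q.
    move=> pP qQ; have pA := subsetP PA _ pP;
      rewrite garcN ?neq ?(subsetP QW) //.
    by have := PQ p q pP qQ; rewrite inE pA.
  have [PS QS] := (subset_trans PA AS, subset_trans QW WS).
  case: b arc {X boat no half PQ} => arc; first exact: tr_join.
  by rewrite addnC; apply: tr_join => // x y xQ yP; apply: arc.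
move=> w x y z wW; rewrite !inE => /andP[xA wx] /andP[yA wy] zA;
  rewrite zA /= => wz xy yz zx.
case/negP: no; apply/exists_inP; exists x => //; apply/exists_inP;
  exists y => //.
apply/exists_inP; exists z => //; apply/exists_inP; exists w => //.
by rewrite xy yz zx wx wy garcN ?wz // neq.
Qed.

Section Embedding.
Variables (H : tournament) (theta : seq H).
Hypothesis theta_ord : ordering theta.
Local Notation pos v := (index v theta).
Local Notation B := (backedge_graph theta).

Lemma pos_lt v : pos v < #|H|.
Proof.
have mem : v \in theta by rewrite (perm_mem theta_ord) mem_enum.
by rewrite cardE -(perm_size theta_ord) index_mem.
Qed.

Lemma pos_inj : injective (fun v => pos v).
Proof.
move=> u v uv; have mem w :
  w \in theta by rewrite (perm_mem theta_ord) mem_enum.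
by rewrite -(nth_index u (mem u)) uv nth_index.
Qed.

Lemma backedge_sym u v : B u v = B v u.
Proof. by rewrite /backedge_graph orbC. Qed.

Lemma backedge_darc u v : pos u < pos v -> darc v u = B u v.
Proof.
move=> lt; rewrite /backedge_graph /backward lt andbT.
by rewrite [_ < pos u]ltnNge (ltnW lt) andbF.
Qed.

Lemma non_backedge_darc u v : pos u < pos v -> darc u v = ~~ B u v.
Proof.
move=> lt; rewrite darcN ?backedge_darc //.
by apply: contraTneq lt => ->; rewrite ltnn.
Qed.

(* The three consecutive vertices of either boat form a cyclic triangle, and
   the fourth vertex is adjacent through backward arcs to exactly two of
   them; [c] serves as the position of the triangle. *)
Lemma boat_shape C : left_boat theta C \/ right_boat theta C ->
  exists a b c d, let s := pos c < pos d in
  [/\ C = [set a; b; c; d],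
      [/\ darc a b, darc b c & darc c a],
      [/\ garc s d a, garc s d b & garc s c d] &
      forall v u, v \in [set a; b;
        c] -> u \notin C -> (pos u < pos v) = (pos u < pos c)].
Proof.
have arcs v1 v2 v3 v4 : pos v1 < pos v2 -> pos v2 < pos v3 -> pos v3 < pos v4 ->
    boat_edges B v1 v2 v3 v4 ->
    [/\ darc v1 v2, darc v2 v3 & darc v3 v4] /\
      [/\ darc v3 v1, darc v4 v1 & darc v4 v2].
  move=> lt12 lt23 lt34 /and5P[b13 b14 b24 n12 /andP[n23 n34]].
  have lt13 := ltn_trans lt12 lt23; have lt24 := ltn_trans lt23 lt34.
  have lt14 := ltn_trans lt12 lt24.
  by do 2!split; try (by rewrite backedge_darc); rewrite non_backedge_darc.
case=> -[v1 [v2 [v3 [v4]]]] /= [eC /and3P[lt12 lt23 lt34] [e1 e2]] edges;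
  have [[d12 d23 d34] [d31 d41 d42]] := arcs _ _ _ _ lt12 lt23 lt34 edges.
  exists v1, v2, v3, v4; rewrite /= lt34 /garc; split=> //.
  (* No vertex outside [C] can stand between three consecutive positions. *)
  move=> v u vC uC.
  have nu w : w \in C -> pos u != pos w by move=> wC;
    apply: contraNneq uC => /pos_inj->.
  have := nu v1; have := nu v2; have := nu v3; rewrite eC !inE !eqxx ?orbT.
  move=> /(_ isT) ne1 /(_ isT) ne2 /(_ isT) ne3.
  by move: vC; rewrite !inE -orbA => /or3P[] /eqP->; lia.
(* The triangle of a right boat is rotated so that [c] is [v2], the vertex joined to [v1] by a
   forward arc. *)
exists v3, v4, v2, v1; rewrite /= [_ < pos v1]ltnNge (ltnW lt12) /garc;
  split=> //.
- by rewrite eC; apply/setP=> x; rewrite !inE; do 4!case: (x == _).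
move=> v u vC uC.
have nu w : w \in C -> pos u != pos w by move=> wC;
  apply: contraNneq uC => /pos_inj->.
have := nu v2; have := nu v3; have := nu v4; rewrite eC !inE !eqxx ?orbT.
move=> /(_ isT) ne1 /(_ isT) ne2 /(_ isT) ne3.
by move: vC; rewrite !inE -orbA => /or3P[] /eqP->; lia.
Qed.

(** Components of [B] are embedded one at a time, the triangle into [A (pos c)] and the fourth
    vertex into [A (pos d)]. Arcs between components are all forward, which smoothness provides.
    Candidate sets lose at most half of [A k], whence [2 * D]. *)
Lemma boats_embed (T : tournament) (S : {set T}) (A : nat ->
  {set T}) (L D : nat) :
  (forall C : {set H}, component B C ->
    left_boat theta C \/ right_boat theta C) ->
  4 <= L -> 2 * #|H| <= L ->
  (forall i, i < #|H| -> A i \subset S /\ #|S| <= D * #|A i|) ->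
  (forall i k, i < #|H| -> k < #|H| -> i != k -> [disjoint A i & A k] /\
     forall x, x \in A i -> L * #|[set a in A k | ~~ garc (i < k) x a]| <= #|A
       k|) ->
  1 < tr S ->
  (forall P : {set T}, P \subset S -> #|S| <= 16 * (2 * D) * #|P| ->
    tr S < 2 * tr P) ->
  (forall P : {set T}, P \subset S -> 2 * tr P <= tr S ->
     8 * (2 * D) * #|P| * tr S ^ 2 <= #|S| * tr P ^ 2) ->
  exists f : H -> T, forall u v, darc u v -> darc (f u) (f v).
Proof.
have arith1 (h e m n r : nat) : 2 * h <= L -> e <= h -> m <= n + r ->
    L * r <= e * m -> 4 <= L -> m <= 2 * n.
  move=> hL eh le le' L4; have [h0|h0] := posnP h; first by nia.
  have : h * (2 * r) <= h * m by nia.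
  by rewrite leq_pmul2l //; lia.
have arith2 (n m k : nat) : n <= D * m -> m <= 2 * k -> n <= 2 * D * k by nia.
have arith3 (e r m n : nat) : 4 <= L -> e <= r -> L * r <= m ->
  m <= 2 * n -> 2 * e <= n.
  by nia.
move=> boats L4 LH AP smooth t1 large small.
pose bad k u (f : H -> T) v := [set a in A k | ~~ garc (pos u < pos v) (f u) a].
(* [E] is a union of components already embedded; the last clause keeps the sets of all future
   vertices almost intact. *)
pose inv (E : {set H}) (f : H -> T) :=
  [/\ forall u v, u \in E -> B u v -> v \in E,
      forall u v, u \in E -> v \in E -> darc u v -> darc (f u) (f v) &
      forall u v, u \in E -> v \notin E ->
        L * #|bad (pos v) u f v| <= #|A (pos v)|].
have [x0 _] : exists x0, x0 \in S.
  by apply/card_gt0P; have := tr_le_card S; lia.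
suff step E f v0 : inv E f -> v0 \notin E ->
  exists E' f', inv E' f' /\ E \proper E'.
  have inv0 : inv set0 (fun=> x0) by split=> u v; rewrite inE.
  have : exists E f, inv E f /\ #|~: E| <= #|H|.
    by exists set0, (fun=> x0); split=> //; apply: max_card.
  elim: #|H| => [|n IH] [E [f [Ef le]]].
    have all_E u : u \in E by move: le;
      rewrite leqn0 cards_eq0 -setCT => /eqP/setC_inj->; rewrite inE.
    by exists f => u v; have [_ fP _] := Ef; apply: fP.
  have [/eqP|/set0Pn[v0]] := boolP (~: E == set0).
    by move=> E0; apply: IH; exists E, f; rewrite E0 cards0.
  rewrite inE => /(step _ _ _ Ef) [E' [f' [Ef' sub]]].
  apply: IH; exists E', f'; split=> //.
  have := proper_card sub; have := cardsC E; have := cardsC E'; lia.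
move=> [Ecl fP fbad] v0E.
pose C := [set w | connect B v0 w].
have v0C : v0 \in C by rewrite inE connect0.
have Bsym : connect_sym B by apply: sym_connect_sym => u v; apply: backedge_sym.
have Ccl u v : u \in C -> B u v -> v \in C.
  by rewrite !inE => v0u uv; apply: connect_trans v0u (connect1 uv).
have EC u : u \in E -> u \notin C.
  move=> uE; rewrite inE; apply: contra v0E => v0u.
  have cl : closed B (mem E) by apply: intro_closed => // x y xy xE;
    apply: Ecl xy.
  by rewrite (closed_connect cl v0u).
have CE u : u \in C -> u \notin E by apply: contraL; apply: EC.
have [|a [b [c [d /=]]]] := @boat_shape C _; first by apply: boats; exists v0.
set s := pos c < pos d; move=> [eC [ab bc ca] [da db cd] posC].
have aC : a \in C by rewrite eC !inE eqxx.
have bC : b \in C by rewrite eC !inE eqxx ?orbT.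
have cC : c \in C by rewrite eC !inE eqxx ?orbT.
have dC : d \in C by rewrite eC !inE eqxx ?orbT.
(* These vertices are correctly joined to all images chosen so far. At most [#|H|] images each spoil
   a share [1 / L], and [2 * #|H| <= L]. *)
pose cand k := [set x in A k | [forall u in E, garc (pos u < k) (f u) x]].
have candA k : cand k \subset A k by apply/subsetP=> x; rewrite inE => /andP[].
have card_cand v : v \notin E -> #|A (pos v)| <= 2 * #|cand (pos v)|.
  move=> vE.
  have sub : A (pos v) \subset cand (pos v) :|: \bigcup_(u in E) bad (pos v) u
    f v.
    apply/subsetP=> x xA; rewrite inE; have [//|] := boolP (x \in cand _).
    rewrite inE xA /= => /forall_inPn[u uE nux].
    by apply/bigcupP; exists u; rewrite // inE xA.
  have le : #|A (pos v)| <= #|cand (pos v)| + \sum_(u in E) #|bad (pos v) u f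
    v|.
    apply: leq_trans (subset_leq_card sub) _.
    apply: leq_trans (leq_card_setU _ _) _.
    by rewrite leq_add2l leq_card_bigcup.
  have : L * \sum_(u in E) #|bad (pos v) u f v| <= #|E| * #|A (pos v)|.
    by rewrite big_distrr -sum_nat_const; apply: leq_sum => u uE; apply: fbad.
  by move=> leE; apply: (arith1 _ _ _ _ _ LH (max_card (mem E)) le leE).
have cNd : c != d.
  apply: contraTneq cd => ->; rewrite /garc.
  by case: (s); rewrite darc_irr.
have pcd : pos c != pos d by apply: contraNneq cNd => /(@pos_inj)->.
have pdc : pos d != pos c by rewrite eq_sym.
have [disj _] := smooth _ _ (pos_lt c) (pos_lt d) pcd.
have AS v : cand (pos v) \subset S.
  by apply: subset_trans (candA _) _; have [] := AP _ (pos_lt v).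
have cS v : v \notin E -> #|S| <= 2 * D * #|cand (pos v)|.
  by move=> /card_cand; have [_] := AP _ (pos_lt v); apply: arith2.
have [] := @boat_exists T S (cand (pos c)) (cand (pos d)) s (2 * D) => //.
- exact: disjointW disj.
- exact: cS (CE _ cC).
- exact: cS (CE _ dC).
(* As [4 <= L], wrong arcs from [w] reach at most a quarter of [A (pos c)], hence at most half of
   the candidates. *)
- move=> w /(subsetP (candA _)) wA.
  have [_ /(_ w wA) sm] := smooth _ _ (pos_lt d) (pos_lt c) pdc.
  have leX : #|[set e in cand (pos c) | garc s w e]| <=
             #|[set e in A (pos c) | ~~ garc (pos d < pos c) w e]|.
    apply: subset_leq_card; apply/subsetP=> e;
      rewrite !inE => /andP[/andP[-> _] we] /=.
    rewrite ltnNge leq_eqVlt (negbTE pcd) /= -/s /garc.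
    by case: (s) we => /darc_asym->.
  exact: (arith3 _ _ _ _ L4 leX sm (card_cand c (CE _ cC))).
move=> x [y [z [w [[xA yA zA wA] [[xy yz zx] [wx wy zw]]]]]].
pose f' u := if u == a then x else if u == b then y else if u == c then z
             else if u == d then w else f u.
have f'a : f' a = x by rewrite /f' eqxx.
have f'b : f' b = y by rewrite /f' eqxx eq_sym (negbTE (darc_neq ab)).
have f'c : f' c = z by rewrite /f' eqxx (negbTE (darc_neq ca)) eq_sym (negbTE
  (darc_neq bc)).
have f'd : f' d = w.
  rewrite /f' eqxx [d == c]eq_sym (negbTE cNd).
  have neq (u v : H) : garc s u v -> (u == v) = false.
    by apply: contraTF => /eqP->; rewrite /garc; case: (s); rewrite darc_irr.
  by rewrite (neq _ _ da) (neq _ _ db).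
have f'E u : u \in E -> f' u = f u.
  move=> uE; have neq v : v \in C -> (u == v) = false.
    by move=> vC; apply: contraNF (CE _ vC) => /eqP<-.
  by rewrite /f' !neq.
have tri v : v \in C -> v != d -> f' v \in cand (pos c) /\
    forall u, u \notin C -> (pos u < pos v) = (pos u < pos c).
  move=> vC vd; have v3 : v \in [set a; b; c].
    by move: vC; rewrite eC !inE (negbTE vd) orbF.
  split; last by move=> u uC; apply: posC.
  by case/setUP: v3 => [/set2P[]|/set1P] ->; rewrite ?f'a ?f'b ?f'c.
have new u v : u \in E -> v \in C -> garc (pos u < pos v) (f u) (f' v).
  move=> uE vC; have uC := EC u uE; have [->|vd] := eqVneq v d.
    by rewrite f'd; move: wA; rewrite inE => /andP[_ /forall_inP]; apply.
  have [vA ->] := tri v vC vd; last by [].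
  by move: vA; rewrite inE => /andP[_ /forall_inP]; apply.
have newB u v : u \in E -> v \in C -> ~~ B u v.
  by move=> uE vC; apply: contra (CE v vC); apply: Ecl.
have cross u v : u \in E -> v \in C -> darc u v = (pos u < pos v).
  move=> uE vC; have uv : u != v by apply: contraTneq uE => ->; apply: CE.
  have [lt|lt|/pos_inj euv] := ltngtP (pos u) (pos v).
  - by rewrite non_backedge_darc // newB.
  - by rewrite backedge_darc // backedge_sym (negbTE (newB _ _ uE vC)).
  - by rewrite euv eqxx in uv.
exists (E :|: C), f'; split; last first.
  rewrite properE subsetUl; apply/subsetPn; exists v0 => //.
  by rewrite inE v0C orbT.
split.
- move=> u v /setUP[uE|uC] uv; apply/setUP; first by left; apply: Ecl uv.
  by right; apply: Ccl uv.
- move=> u v /setUP[uE|uC] /setUP[vE|vC] uv.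
  + by rewrite !f'E //; apply: fP.
  + by rewrite (f'E u uE); have := new u v uE vC; rewrite -(cross u v uE vC) uv.
  + by rewrite (f'E v vE); have := new v u vE uC;
      rewrite -(cross v u vE uC) (darc_asym uv).
  move: uC vC uv; rewrite eC !inE -!orbA.
  have xy' := darc_asym ab; have yz' := darc_asym bc; have zx' := darc_asym ca.
  have ad := garc_asym da; have bd := garc_asym db; have dc := garc_asym cd.
  move: da db cd wx wy zw ad bd dc; rewrite /garc => da db cd wx wy zw ad bd dc.
  move=> /or4P[] /eqP-> /or4P[] /eqP->;
    rewrite ?f'a ?f'b ?f'c ?f'd ?darc_irr ?xy' ?yz' ?zx' //;
  by move: da db cd wx wy zw ad bd dc; case: (s) => ? ? ? ? ? ? ad bd dc;
    rewrite ?ad ?bd ?dc.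
move=> u v /setUP[uE|uC]; rewrite inE negb_or => /andP[vE vC].
  by rewrite /bad f'E //; apply: fbad.
have neq e : e \in C -> pos e != pos v.
  by move=> eC'; apply: contraNneq vC => /(@pos_inj)<-.
have [eud|ud] := eqVneq u d.
  rewrite /bad eud f'd; have [_] := smooth _ _ (pos_lt d) (pos_lt v) (neq d dC).
  by apply; apply: (subsetP (candA _)).
have [uA lt] := tri u uC ud.
(* The image of a triangle vertex [u] lies in [A (pos c)], not in [A (pos u)]; this is harmless
   because [v] is on the same side of [u] and [c]. *)
have -> : bad (pos v) u f' v = [set e in A (pos v) | ~~ garc (pos c < pos v)
  (f' u) e].
  rewrite /bad; suff -> : (pos u < pos v) = (pos c < pos v) by [].
  have swap (i j : nat) : i != j -> (i < j) = ~~ (j < i) by case: ltngtP.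
  by rewrite (swap _ _ (neq u uC)) (swap _ _ (neq c cC)) (lt v vC).
have [_] := smooth _ _ (pos_lt c) (pos_lt v) (neq c cC).
by apply; apply: (subsetP (candA _)).
Qed.

End Embedding.

(** * The polynomial bound, by induction on the size of [S] *)

Lemma flotilla_tr (H : tournament) : flotilla H ->
  exists k, 0 < k /\ forall T : tournament, ~ contains T H ->
    forall S : {set T}, #|S| <= tr S ^ k.
Proof.
case=> theta theta_ord boats.
pose L := 2 * #|H| + 4.
have [D [N DNP]] := smooth_sequence H L #|H|.
have arith (a b c d e p : nat) : 4 * a * b <= c -> c < d -> d <= e * p ->
  p <= b ->
    0 < b -> e <= a -> False.
  move=> h1 h2 h3 h4 h5 h6; have : e * p <= a * b by apply: leq_mul.
  by nia.
(* The summand 2 splits off a factor 4 in [large] and the squares in [small]; the rest makes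
   [2 ^ (k - 2)] exceed [16 * (2 * D) + N]. *)
pose k := 16 * (2 * D) + N + 2.
exists k; split=> [|T Hfree S]; first by rewrite /k addn2.
have big_k m : m <= 16 * (2 * D) + N -> m <= 2 ^ (k - 2).
  by rewrite /k addnK => /leq_trans; apply; apply/ltnW/ltn_expl.
move: {2}_.+1 (ltnSn #|S|) => n; elim: n S => // n IH S leS.
rewrite leqNgt; apply/negP=> ltS.
have crit (P : {set T}) : P \proper S -> #|P| <= tr P ^ k.
  by move=> /proper_card PS; apply: IH; apply: leq_trans PS _.
have S_gt0 : 0 < #|S| by apply: leq_ltn_trans ltS.
have t0 := tr_gt0 S_gt0.
have t1 : 1 < tr S.
  by apply/tr_gt1/(leq_ltn_trans _ ltS); rewrite expn_gt0 t0.
have kE : 2 ^ k = 4 * 2 ^ (k - 2).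
  by rewrite -(expnD 2 2) subnKC // /k; lia.
have [|A [AP smooth]] := DNP T S Hfree.
  apply: leq_trans (ltnW ltS); apply: leq_trans (_ : 2 ^ k <= _).
    by rewrite kE; have := big_k N; lia.
  by rewrite leq_exp2r // /k addn2.
(* If [tr P] were at most half of [tr S], minimality would give [|P| < |S| / 2 ^ k], below the
   assumed proportion. *)
have large (P : {set T}) : P \subset S -> #|S| <= 16 * (2 * D) * #|P| ->
  tr S < 2 * tr P.
  move=> PS le; have [->|PneS] := eqVneq P S; first by lia.
  have cP : #|P| <= tr P ^ k by apply: crit; rewrite properEneq PneS.
  rewrite ltnNge; apply/negP=> le2.
  have P_gt0 : 0 < #|P| by nia.
  have trP : 0 < tr P ^ k by rewrite expn_gt0 tr_gt0.
  have : (2 * tr P) ^ k <= tr S ^ k by rewrite leq_exp2r // /k addn2.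
  rewrite expnMn kE => le3.
  have := big_k _ (leq_addr N (16 * (2 * D))).
  exact: arith le3 ltS le cP trP.
(* In [tr P ^ k], the factor [tr P ^ (k - 2)] is at most [tr S ^ (k - 2) / 2 ^ (k - 2)], and this
   denominator outweighs [8 * (2 * D)]. *)
have small (P : {set T}) : P \subset S -> 2 * tr P <= tr S ->
    8 * (2 * D) * #|P| * tr S ^ 2 <= #|S| * tr P ^ 2.
  move=> PS le2; have PneS : P != S by apply: contraTneq le2 => ->; lia.
  have cP : #|P| <= tr P ^ k by apply: crit; rewrite properEneq PneS.
  have ek (m : nat) : m ^ k = m ^ 2 * m ^ (k - 2) by rewrite -expnD subnKC //
    /k; lia.
  apply: leq_trans (_ : 2 ^ (k - 2) * (tr P ^ k) * tr S ^ 2 <= _).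
    rewrite leq_mul2r; apply/orP; right; apply: leq_mul => //.
    by apply: big_k; lia.
  apply: leq_trans (_ : tr S ^ k * tr P ^ 2 <= _);
    last by rewrite leq_mul2r ltnW ?orbT.
  rewrite [tr P ^ k]ek [tr S ^ k]ek.
  have : (2 * tr P) ^ (k - 2) <= tr S ^ (k - 2).
    by case: (k - 2) => [|e]; rewrite ?expn0 // leq_exp2r.
  rewrite expnMn; move: (2 ^ _) (tr P ^ (k - 2)) (tr S ^ (k - 2)) (tr P ^ 2)
    (tr S ^ 2).
  move=> a b c d e le; suff : a * b * (d * e) <= c * (d * e) by lia.
  by rewrite leq_mul2r le orbT.
have L4 : 4 <= L by rewrite /L leq_addl.
have LH : 2 * #|H| <= L by rewrite /L leq_addr.
have [f fP] := boats_embed theta_ord boats L4 LH AP smooth t1 large small.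
by apply: Hfree; apply: embedding_contains fP.
Qed.

(** * The real exponent [1 / k] *)

Import Order.TTheory GRing.Theory Num.Theory.

Theorem theorem5 (R : realType) (H : tournament) (hH : flotilla H) :
  erdos_hajnal R H.
Proof.
have [k [k_gt0 kP]] := flotilla_tr hH.
have kR_gt0 : (0 < k%:R :> R)%R by rewrite ltr0n.
exists (k%:R^-1)%R; first by rewrite invr_gt0.
move=> T Hfree; have [P [_ tP cP]] := tr_max [set: T].
exists P; first exact: transitive_subtournament.
have := kP T Hfree [set: T]; rewrite cardsT -cP => le.
have : ((#|T|%:R : R) `^ (k%:R^-1) <= ((#|P| ^ k)%:R : R) `^ (k%:R^-1))%R.
  apply: ge0_ler_powR; rewrite ?nnegrE ?ler0n ?ler_nat //.
  by rewrite invr_ge0 ltW.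
move=> /le_trans; apply.
by rewrite natrX -powR_mulrn ?ler0n // -powRrM mulfV ?lt0r_neq0 // powRr1
  ?ler0n.
Qed.
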